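(* Let $X:\Sigma^n\to\mathbb{R}^{n+m}$ ($n,m\ge1$) be a complete, properly immersed $\lambda$-self-shrinker for the mean curvature flow (MCF) with respect to $\vec 0\in\mathbb{R}^{n+m}$. Suppose that (1) either $X(\Sigma)\subseteq\{x\in\mathbb{R}^{n+m}:\|x\|\le\sqrt{n/\lambda}\}$, (2) or $X(\Sigma)\subseteq\{x\in\mathbb{R}^{n+m}:\|x\|\ge\sqrt{n/\lambda}\}$. Then $\Sigma^n$ is compact, $X(\Sigma)\subseteq S^{n+m-1}\big(\sqrt{\tfrac n\lambda}\big)$, and $X:\Sigma\to S^{n+m-1}\big(\sqrt{\tfrac n\lambda}\big)$ is a minimal immersion.
   Context: A complete isometric immersion $X:\Sigma^n\to\mathbb{R}^{n+m}$ of an $n$-dimensional Riemannian manifold is a $\lambda$-self-shrinker for the MCF with respect to $\vec 0$ if $\lambda>0$ and $\vec H=-\lambda X^\perp$, where $\vec H$ is the mean curvature vector of $X$ (the trace of the second fundamental form, so $\vec H=\Delta^\Sigma X$) and $X^\perp$ is the component of the position vector $X$ normal to $\Sigma$. $S^{n+m-1}(R)$ is the sphere of radius $R$ centered at $\vec 0$ in $\mathbb{R}^{n+m}$. *)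

(* Defs.v *)
From mathcomp Require Import all_boot all_order all_algebra.
From mathcomp Require Import all_classical all_reals all_analysis.

Set Implicit Arguments.
Unset Strict Implicit.
Unset Printing Implicit Defensive.

Import Order.TTheory GRing.Theory Num.Theory.
Import numFieldNormedType.Exports.

Local Open Scope classical_set_scope.
Local Open Scope ring_scope.

(* The library norm on ['rV[R]_k] is the sup norm, hence the explicit Euclidean
   one here; both induce the same topology and the same differentiable maps. *)
Definition dotv (R : realType) (k : nat) (u v : 'rV[R]_k) : R :=
  \sum_(i < k) u 0 i * v 0 i.

Definition enorm (R : realType) (k : nat) (u : 'rV[R]_k) : R :=
  Num.sqrt (dotv u u).

Definition esphere (R : realType) (k : nat) (r : R) : set 'rV[R]_k :=
  [set x | enorm x = r].

(* For A with linearly independent rows, [v *m A^T *m invmx (A *m A^T) *m A] is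
   the Euclidean orthogonal projection of v onto the row space of A, so
   [normal_part A v] is its projection onto the orthogonal complement. *)
Definition normal_part (R : realType) (l k : nat) (A : 'M[R]_(l, k))
    (v : 'rV[R]_k) : 'rV[R]_k :=
  v - v *m A^T *m invmx (A *m A^T) *m A.

(* C^k maps on an open set U: since U is open, the derivatives at points of U
   do not depend on the values of f outside U. *)
Fixpoint Ck_on (R : realType) (V W : normedModType R) (k : nat) (U : set V)
    (f : V -> W) : Prop :=
  if k is k'.+1 then
    (forall x, U x -> differentiable f x) /\
    (forall v : V, Ck_on k' U (fun x => 'D_v f x))
  else forall x, U x -> {for x, continuous f}.

Definition smooth_on (R : realType) (V W : normedModType R) (U : set V)
    (f : V -> W) : Prop :=
  forall k, Ck_on k U f.

Definition basis_vec (R : realType) (n : nat) (i : 'I_n) : 'rV[R]_n :=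
  delta_mx 0 i.

(* Row i is the i-th partial derivative of f. *)
Definition jac (R : realType) (n k : nat) (f : 'rV[R]_n -> 'rV[R]_k)
    (x : 'rV[R]_n) : 'M[R]_(n, k) :=
  \matrix_(i < n) 'D_(basis_vec R i) f x.

Definition partial2 (R : realType) (n k : nat) (f : 'rV[R]_n -> 'rV[R]_k)
    (i j : 'I_n) (x : 'rV[R]_n) : 'rV[R]_k :=
  'D_(basis_vec R i) (fun y => 'D_(basis_vec R j) f y) x.

(* A homeomorphism between an open subset of M and an open subset of R^n; both
   maps are total functions whose values outside these sets are irrelevant. *)
Record chart (R : realType) (n : nat) (M : topologicalType) := Chart {
  chart_dom : set M ;
  chart_cod : set 'rV[R]_n ;
  chart_map : M -> 'rV[R]_n ;
  chart_inv : 'rV[R]_n -> M ;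
  chart_dom_open : open chart_dom ;
  chart_cod_open : open chart_cod ;
  chart_map_cod : forall p, chart_dom p -> chart_cod (chart_map p) ;
  chart_inv_dom : forall x, chart_cod x -> chart_dom (chart_inv x) ;
  chart_mapK : forall p, chart_dom p -> chart_inv (chart_map p) = p ;
  chart_invK : forall x, chart_cod x -> chart_map (chart_inv x) = x ;
  chart_map_continuous :
    forall p, chart_dom p -> {for p, continuous chart_map} ;
  chart_inv_continuous :
    forall x, chart_cod x -> {for x, continuous chart_inv}
}.

Definition transition (R : realType) (n : nat) (M : topologicalType)
    (c c' : chart R n M) : 'rV[R]_n -> 'rV[R]_n :=
  chart_map c' \o chart_inv c.

Definition overlap (R : realType) (n : nat) (M : topologicalType)
    (c c' : chart R n M) : set 'rV[R]_n :=
  [set x | chart_cod c x /\ chart_dom c' (chart_inv c x)].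

(* A smooth n-manifold (not assumed connected) with a smooth Riemannian metric;
   [metric c x] is the matrix (g_ij) of the metric, in the chart c, at the
   point of coordinates x. *)
Record riemannian_manifold (R : realType) (n : nat) := RiemannianManifold {
  carrier :> topologicalType ;
  carrier_hausdorff : hausdorff_space carrier ;
  carrier_second_countable : @second_countable carrier ;
  atlas : set (chart R n carrier) ;
  atlas_cover : forall p : carrier, exists2 c, atlas c & chart_dom c p ;
  atlas_smooth : forall c c', atlas c -> atlas c' ->
    smooth_on (overlap c c') (transition c c') ;
  metric : chart R n carrier -> 'rV[R]_n -> 'M[R]_n ;
  metric_smooth : forall c, atlas c -> forall i j,
    smooth_on (chart_cod c) (fun x => metric c x i j) ;
  metric_sym : forall c x, atlas c -> chart_cod c x ->
    (metric c x)^T = metric c x ;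
  metric_pos : forall c x, atlas c -> chart_cod c x ->
    forall v : 'rV[R]_n, v != 0 -> 0 < (v *m metric c x *m v^T) 0 0 ;
  metric_transition : forall c c' x, atlas c -> atlas c' -> overlap c c' x ->
    metric c x = jac (transition c c') x *m metric c' (transition c c' x)
                 *m (jac (transition c c') x)^T
}.

(* A C^1 curve on [0, 1] inside the domain of the chart c, in coordinates. A
   curve that is C^1 on the closed interval always extends to a C^1 one on R. *)
Definition C1_curve_in (R : realType) (n : nat) (S : riemannian_manifold R n)
    (c : chart R n S) (eta : R -> 'rV[R]_n) : Prop :=
  Ck_on 1 [set: R] eta /\ forall t, 0 <= t <= 1 -> chart_cod c (eta t).

Definition curve_length (R : realType) (n : nat) (S : riemannian_manifold R n)
    (c : chart R n S) (eta : R -> 'rV[R]_n) : R :=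
  \int[@lebesgue_measure R]_(t in `[0, 1])
    Num.sqrt (('D_1 eta t *m metric c (eta t) *m ('D_1 eta t)^T) 0 0).

(* [path_of_length p q l]: a piecewise C^1 curve of length l joins p to q. By
   compactness such a curve is a concatenation of finitely many C^1 pieces, each
   contained in the domain of one chart. *)
Inductive path_of_length (R : realType) (n : nat) (S : riemannian_manifold R n)
    : S -> S -> R -> Prop :=
| path_nil (p : S) : path_of_length p p 0
| path_cons (c : chart R n S) (eta : R -> 'rV[R]_n) (q : S) (l : R) :
    atlas c -> C1_curve_in c eta ->
    path_of_length (chart_inv c (eta 1)) q l ->
    path_of_length (chart_inv c (eta 0)) q (curve_length c eta + l).

(* Riemannian distance (+oo between distinct connected components). *)
Definition riem_dist (R : realType) (n : nat) (S : riemannian_manifold R n)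
    (p q : S) : \bar R :=
  ereal_inf [set l%:E | l in [set l | path_of_length p q l]].

Definition complete_manifold (R : realType) (n : nat)
    (S : riemannian_manifold R n) : Prop :=
  forall u : nat -> S,
    (forall eps : R, 0 < eps -> exists N, forall i j,
       (N <= i)%N -> (N <= j)%N -> (riem_dist (u i) (u j) < eps%:E)%E) ->
    exists p : S, forall eps : R, 0 < eps -> exists N, forall i,
       (N <= i)%N -> (riem_dist (u i) p < eps%:E)%E.

Definition in_chart (R : realType) (n k : nat) (M : topologicalType)
    (X : M -> 'rV[R]_k) (c : chart R n M) : 'rV[R]_n -> 'rV[R]_k :=
  X \o chart_inv c.

Definition smooth_map (R : realType) (n k : nat) (S : riemannian_manifold R n)
    (X : S -> 'rV[R]_k) : Prop :=
  forall c, atlas c -> smooth_on (chart_cod c) (in_chart X c).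

(* The rows of [tangent_frame X c p] are the images under dX of the coordinate
   vectors of the chart c at p; their span is the tangent space dX(T_p S). *)
Definition tangent_frame (R : realType) (n k : nat) (M : topologicalType)
    (X : M -> 'rV[R]_k) (c : chart R n M) (p : M) : 'M[R]_(n, k) :=
  jac (in_chart X c) (chart_map c p).

Definition immersion (R : realType) (n k : nat) (S : riemannian_manifold R n)
    (X : S -> 'rV[R]_k) : Prop :=
  smooth_map X /\
  forall c p, atlas c -> chart_dom c p -> row_free (tangent_frame X c p).

Definition isometric_immersion (R : realType) (n k : nat)
    (S : riemannian_manifold R n) (X : S -> 'rV[R]_k) : Prop :=
  immersion X /\
  forall c p, atlas c -> chart_dom c p -> forall i j,
    metric c (chart_map c p) i j =
    dotv (row i (tangent_frame X c p)) (row j (tangent_frame X c p)).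

Definition proper_immersion (R : realType) (n k : nat)
    (S : riemannian_manifold R n) (X : S -> 'rV[R]_k) : Prop :=
  immersion X /\ forall K : set 'rV[R]_k, compact K -> compact (X @^-1` K).

(* Second fundamental form in R^k on the coordinate vectors i, j: the normal
   part of the flat covariant derivative, which here is d_i d_j X. *)
Definition second_fund_form (R : realType) (n k : nat) (M : topologicalType)
    (X : M -> 'rV[R]_k) (c : chart R n M) (p : M) (i j : 'I_n) : 'rV[R]_k :=
  normal_part (tangent_frame X c p)
    (partial2 (in_chart X c) i j (chart_map c p)).

(* Second fundamental form of X seen as an immersion into the sphere centred at
   0 through X p: the Levi-Civita connection of the sphere is the flat
   derivative projected onto the tangent space of the sphere, i.e. onto the
   orthogonal complement of the line spanned by X p. *)
Definition sphere_second_fund_form (R : realType) (n k : nat)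
    (M : topologicalType) (X : M -> 'rV[R]_k) (c : chart R n M) (p : M)
    (i j : 'I_n) : 'rV[R]_k :=
  normal_part (tangent_frame X c p)
    (normal_part (X p) (partial2 (in_chart X c) i j (chart_map c p))).

Definition metric_trace (R : realType) (n k : nat) (S : riemannian_manifold R n)
    (c : chart R n S) (p : S) (B : 'I_n -> 'I_n -> 'rV[R]_k) : 'rV[R]_k :=
  \sum_(i < n) \sum_(j < n) invmx (metric c (chart_map c p)) i j *: B i j.

(* These vectors do not depend on the chart; the definitions below nevertheless
   quantify over all charts of the atlas containing the point. *)
Definition mean_curvature (R : realType) (n k : nat)
    (S : riemannian_manifold R n) (X : S -> 'rV[R]_k) (c : chart R n S)
    (p : S) : 'rV[R]_k :=
  metric_trace c p (second_fund_form X c p).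

Definition sphere_mean_curvature (R : realType) (n k : nat)
    (S : riemannian_manifold R n) (X : S -> 'rV[R]_k) (c : chart R n S)
    (p : S) : 'rV[R]_k :=
  metric_trace c p (sphere_second_fund_form X c p).

Definition self_shrinker (R : realType) (n k : nat)
    (S : riemannian_manifold R n) (lambda : R) (X : S -> 'rV[R]_k) : Prop :=
  [/\ complete_manifold S, isometric_immersion X, 0 < lambda &
      forall c p, atlas c -> chart_dom c p ->
        mean_curvature X c p =
        - (lambda *: normal_part (tangent_frame X c p) (X p))].

Definition minimal_immersion_in_sphere (R : realType) (n k : nat)
    (S : riemannian_manifold R n) (r : R) (X : S -> 'rV[R]_k) : Prop :=
  [/\ isometric_immersion X, (forall p, esphere r (X p)) &
      forall c p, atlas c -> chart_dom c p -> sphere_mean_curvature X c p = 0].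

(* Main.v *)
(** Put [u = |X|^2] and [r2 = n / lambda]. The equation [H = - lambda X^perp] is
    [L u = 2 (n - lambda u)] for the drift Laplacian
    [L f = Delta f - lambda <X, grad f>], so the gap [w = +- (u - r2)], which
    either confinement makes nonnegative, solves [L w = - 2 lambda w <= 0]. By
    the strong minimum principle (Hopf's barrier argument in a chart) the set
    [w = 0] is open. If [w] were positive somewhere, then, [X] being proper, [w]
    would attain its minimum over the open and closed set [w > 0]; there
    [L w >= 0], against [L w = - 2 lambda w < 0]. Hence [|X|^2 = r2], and
    properness makes [S] compact. The position vector is then normal, and
    projecting the shrinker equation to the sphere gives minimality. *)

Require Import Defs.
From mathcomp Require Import all_boot all_order all_algebra.
From mathcomp Require Import all_classical all_reals all_analysis.
From mathcomp Require Import ring lra.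

Set Implicit Arguments.
Unset Strict Implicit.
Unset Printing Implicit Defensive.

Import Order.TTheory GRing.Theory Num.Theory.
Import numFieldNormedType.Exports.

Local Open Scope classical_set_scope.
Local Open Scope ring_scope.

(** * Calculus preliminaries: minima and second derivatives along lines *)

Lemma is_deriveE (R : numFieldType) (V W : normedModType R) (f : V -> W)
    (x v : V) (df : W) :
  is_derive x v f df -> 'D_v f x = df.
Proof. by case. Qed.

Lemma is_derive_derivable (R : numFieldType) (V W : normedModType R)
    (f : V -> W) (x v : V) (df : W) :
  is_derive x v f df -> derivable f x v.
Proof. by case. Qed.

Lemma compact_argmin (T : topologicalType) (R : realType) (f : T -> R)
    (A : set T) :
  A !=set0 -> compact A -> (forall x, A x -> {for x, continuous f}) ->
  exists2 c, A c & forall t, A t -> f c <= f t.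
Proof.
move=> A0 cA cf.
have cfA : {within A, continuous f}.
  by apply: continuous_in_subspaceT => x /set_mem; exact: cf.
have [c /set_mem Ac cmin] := compact_EVT_min A0 cA cfA.
by exists c => // t At; apply: cmin; exact: mem_set.
Qed.

Section line_restriction.
Context {R : realType} {V W : normedModType R}.
Implicit Types (f : V -> W) (x v : V).

(** The two difference quotients are the same function of the increment, so derivability and value
    transfer together. *)
Lemma is_derive_line f x v (t : R) (df : W) :
  is_derive (t *: v + x) v f df ->
  is_derive t 1 (fun h : R => f (h *: v + x)) df.
Proof.
have eqg : (fun h : R => h^-1 *: ((f \o shift (t *: v + x)) (h *: v)
      - f (t *: v + x))) =
    (fun h => h^-1 *: (((fun h : R => f (h *: v + x)) \o shift t) (h *: 1)
      - f (t *: v + x))).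
  by apply/funext => h /=; rewrite [h *: 1]mulr1 addrA -scalerDl.
move=> [dfx <-]; split; last by rewrite /derive eqg.
by move: dfx; rewrite /derivable eqg.
Qed.

End line_restriction.

(** Were the second derivative negative, ['D_1 f] would be negative just to the right of [q], and
    the mean value theorem would give a value of [f] below [f q]. *)
Lemma local_min_derive (R : realType) (f : R -> R) (q : R) :
  (\forall x \near q, f q <= f x) ->
  (\forall x \near q, derivable f x 1) -> derivable ('D_1 f) q 1 ->
  'D_1 f q = 0 /\ 0 <= 'D_1 ('D_1 f) q.
Proof.
move=> qmin df ddf.
have /nbhs_ballP[d /= d0 Hd] : \forall x \near q, f q <= f x /\ derivable f x 1.
  by near do split.
have inball x : `|q - x| < d -> f q <= f x /\ derivable f x 1 by exact: Hd.
have Df0 : 'D_1 f q = 0.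
  apply: (is_deriveE (@derive1_at_min R f (q - d) (q + d) q _ _ _ _)).
  - by rewrite lerD2l; lra.
  - move=> t; rewrite in_itv/= => /andP[h1 h2].
    by apply: (inball t _).2; rewrite ltr_norml; apply/andP; split; lra.
  - by rewrite in_itv/=; apply/andP; split; lra.
  - move=> t; rewrite in_itv/= => /andP[h1 h2].
    by apply: (inball t _).1; rewrite ltr_norml; apply/andP; split; lra.
split=> //; rewrite leNgt; apply/negP => DDlt0.
have : \forall h \near 0^',
    h^-1 *: (('D_1 f \o shift q) (h *: 1) - 'D_1 f q) < 0.
  exact: cvgr_lt ddf _ DDlt0.
rewrite Df0 => /nbhs_ballP[e /= e0 He].
have Dneg (h : R) : 0 < h < e -> 'D_1 f (q + h) < 0.
  move=> /andP[h0 he].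
  have := He h; rewrite /ball/= sub0r normrN gtr0_norm//.
  move=> /(_ he (lt0r_neq0 h0)); rewrite subr0 /= [h *: 1]mulr1 addrC.
  by rewrite [_ *: _]/(_ * _) pmulr_rlt0// invr_gt0.
(* Small enough for both neighbourhoods: minimality and derivability within [d], negative slope
   within [e]. *)
pose h := Num.min d e / 2.
have h0 : 0 < h by rewrite divr_gt0// lt_min d0.
have hd : h < d.
  rewrite /h ltr_pdivrMr//; apply: le_lt_trans (_ : d < _).
    by rewrite ge_min lexx.
  by lra.
have he : h < e.
  rewrite /h ltr_pdivrMr//; apply: le_lt_trans (_ : e < _).
    by rewrite ge_min lexx orbT.
  by lra.
have [|t|t|c] := @MVT R f ('D_1 f) q (q + h).
- by rewrite ltrDl.
- rewrite in_itv/= => /andP[h1 h2]; apply: derivableP; apply: (inball t _).2.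
  by rewrite ltr_norml; apply/andP; split; lra.
- apply: continuous_in_subspaceT => s /set_mem/=.
  rewrite in_itv/= => /andP[h1 h2]; apply: differentiable_continuous.
  apply/derivable1_diffP; apply: (inball s _).2.
  by rewrite ltr_norml; apply/andP; split; lra.
rewrite in_itv/= => /andP[h1 h2] Hmvt.
have : f q <= f (q + h).
  by apply: (inball _ _).1; rewrite ltr_norml; apply/andP; split; lra.
have := Dneg (c - q); rewrite subrKC.
have -> : 0 < c - q < e by apply/andP; split; lra.
move=> /(_ isT) D0; rewrite -subr_ge0 Hmvt addrAC subrr add0r.
by rewrite pmulr_lge0// leNgt D0.
Unshelve. all: by end_near. Qed.

Lemma local_min_derive2 (R : realType) (V : normedModType R) (f : V -> R)
    (q v : V) :
  (\forall x \near q, f q <= f x) ->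
  (\forall x \near q, derivable f x v) -> derivable ('D_v f) q v ->
  'D_v f q = 0 /\ 0 <= 'D_v ('D_v f) q.
Proof.
move=> qmin df ddf.
have cvl : (fun t : R => t *: v + q) @ 0 --> q.
  rewrite -[X in _ --> X]add0r -[X in _ --> X + _](scale0r v).
  by apply: cvgD; [apply: cvgZr_tmp; exact: cvg_id|exact: cvg_cst].
have dfline : \forall t \near (0 : R), derivable f (t *: v + q) v.
  exact: cvl _ df.
(* [f] is derivable along [v] only near [q], so the first derivatives are compared only near
   [t = 0], which suffices to differentiate once more. *)
have E : \forall t \near (0 : R),
    'D_v f (t *: v + q) = 'D_1 (fun t : R => f (t *: v + q)) t.
  near=> t; apply/esym/derive_val; apply: is_derive_line.
  by apply: derivableP; near: t.
have q0 : q = 0 *: v + q by rewrite scale0r add0r.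
have D2 : is_derive (0 : R) 1 ('D_1 (fun t : R => f (t *: v + q)))
    ('D_v ('D_v f) q).
  apply: (near_eq_is_derive E).
  apply: (@is_derive_line _ _ _ ('D_v f) q v 0).
  by rewrite -q0; exact: derivableP.
have [] := @local_min_derive R (fun t : R => f (t *: v + q)) 0.
- by rewrite -q0; exact: cvl _ qmin.
- near=> t; apply: (@is_derive_derivable _ _ _ _ _ _ ('D_v f (t *: v + q))).
  by apply: is_derive_line; apply: derivableP; near: t.
- exact: ex_derive.
move=> D1 D2ge0; split; first by rewrite q0 (nbhs_singleton E).
by move: D2ge0; rewrite (is_deriveE D2).
Unshelve. all: by end_near. Qed.

(** * Euclidean inner product and limits of matrix expressions *)

Section dot_product.
Context {R : realType} {k : nat}.
Implicit Types u v w : 'rV[R]_k.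

Lemma dotvE u v : dotv u v = (u *m v^T) 0 0.
Proof. by rewrite mxE; apply: eq_bigr => i _; rewrite mxE. Qed.

Lemma dotvC u v : dotv u v = dotv v u.
Proof. by apply: eq_bigr => i _; rewrite mulrC. Qed.

Lemma dotvDl u v w : dotv (u + v) w = dotv u w + dotv v w.
Proof. by rewrite !dotvE mulmxDl mxE. Qed.

Lemma dotvDr u v w : dotv u (v + w) = dotv u v + dotv u w.
Proof. by rewrite dotvC dotvDl !(dotvC u). Qed.

Lemma dotvNl u v : dotv (- u) v = - dotv u v.
Proof. by rewrite !dotvE mulNmx mxE. Qed.

Lemma dotvNr u v : dotv u (- v) = - dotv u v.
Proof. by rewrite dotvC dotvNl dotvC. Qed.

Lemma dotvZl (a : R) u v : dotv (a *: u) v = a * dotv u v.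
Proof. by rewrite !dotvE -scalemxAl mxE. Qed.

Lemma dotvZr (a : R) u v : dotv u (a *: v) = a * dotv u v.
Proof. by rewrite dotvC dotvZl dotvC. Qed.

Lemma dotv_suml (I : finType) (F : I -> 'rV[R]_k) v :
  dotv (\sum_i F i) v = \sum_i dotv (F i) v.
Proof.
by rewrite dotvE mulmx_suml summxE; apply: eq_bigr => i _; rewrite dotvE.
Qed.

Lemma dotv_sumr (I : finType) (F : I -> 'rV[R]_k) v :
  dotv v (\sum_i F i) = \sum_i dotv v (F i).
Proof. by rewrite dotvC dotv_suml; apply: eq_bigr => i _; rewrite dotvC. Qed.

Lemma dotv_ge0 u : 0 <= dotv u u.
Proof. by apply: sumr_ge0 => i _; rewrite -expr2 sqr_ge0. Qed.

Lemma dotv_gt0 u : u != 0 -> 0 < dotv u u.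
Proof.
move=> u0; rewrite lt_def dotv_ge0 andbT; apply: contraNneq u0 => /eqP.
rewrite psumr_eq0; last by move=> i _; rewrite -expr2 sqr_ge0.
move=> /allP u0; apply/eqP/rowP => i; apply/eqP.
by have := u0 i (mem_index_enum _); rewrite mulf_eq0 orbb mxE.
Qed.

(** Each squared coordinate is one term of the sum; this compares the sup norm, which defines the
    balls, with Euclidean length. *)
Lemma sqr_norm_le_dotv u : `|u| ^+ 2 <= dotv u u.
Proof.
suff : `|u| <= Num.sqrt (dotv u u).
  by move=> h; rewrite -[leRHS]sqr_sqrtr ?dotv_ge0// lerXn2r ?nnegrE.
rewrite [leLHS]/Num.Def.normr/= mx_normrE bigmax_le// => -[i j] _ /=.
rewrite (ord1 i) -[`| _ |]ger0_norm// -sqrtr_sqr ler_wsqrtr//.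
rewrite real_normK ?num_real// /dotv (bigD1 j)//= -expr2 lerDl.
by apply: sumr_ge0 => l _; rewrite -expr2 sqr_ge0.
Qed.

End dot_product.

Section matrix_limits.
Context {R : realType} {T : Type} {F : set_system T} {FF : Filter F}.

(** The norm is a maximum over finitely many entries, so the entrywise estimates hold simultaneously
    along the filter. *)
Lemma cvg_mxP m n (f : T -> 'M[R]_(m, n)) (M : 'M[R]_(m, n)) :
  f @ F --> M <-> forall i j, (fun x => f x i j) @ F --> M i j.
Proof.
split=> [fM i j|fM].
  exact: (cvg_comp (fun x => f x) (fun N : 'M[R]_(m, n) => N i j) fM
    (@coord_continuous R m n i j M)).
apply/cvgrPdist_le => e e0; near=> x.
rewrite [leLHS]/Num.Def.normr/= mx_normrE (bigmax_le _ (ltW e0))//= => i _.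
rewrite !mxE; move: i; near: x; apply: filter_forall => /= i.
exact: ((cvgrPdist_le _ _).1 (fM i.1 i.2)) _ e0.
Unshelve. all: by end_near. Qed.

Lemma cvg_sumr (I : finType) (f : I -> T -> R) (a : I -> R) :
  (forall i, f i @ F --> a i) -> (fun x => \sum_i f i x) @ F --> \sum_i a i.
Proof. by move=> fa; apply: cvg_big => //; exact: add_continuous. Qed.

Lemma cvg_prodr (I : finType) (f : I -> T -> R) (a : I -> R) :
  (forall i, f i @ F --> a i) -> (fun x => \prod_i f i x) @ F --> \prod_i a i.
Proof.
move=> fa; apply: cvg_big => // -[x y].
by apply: cvgM; [exact: cvg_fst|exact: cvg_snd].
Qed.

Lemma cvg_mulmx m n p (f : T -> 'M[R]_(m, n)) (g : T -> 'M[R]_(n, p))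
    (M : 'M[R]_(m, n)) (N : 'M[R]_(n, p)) :
  f @ F --> M -> g @ F --> N -> (fun x => f x *m g x) @ F --> M *m N.
Proof.
move=> /cvg_mxP fM /cvg_mxP gN; apply/cvg_mxP => i j; rewrite mxE.
under eq_cvg do rewrite mxE.
by apply: cvg_sumr => l; apply: cvgM.
Qed.

Lemma cvg_trmx m n (f : T -> 'M[R]_(m, n)) (M : 'M[R]_(m, n)) :
  f @ F --> M -> (fun x => (f x)^T) @ F --> M^T.
Proof.
move=> /cvg_mxP fM; apply/cvg_mxP => i j; rewrite mxE.
under eq_cvg do rewrite mxE.
exact: fM.
Qed.

Lemma cvg_row m n (i : 'I_m) (f : T -> 'M[R]_(m, n)) (M : 'M[R]_(m, n)) :
  f @ F --> M -> (fun x => row i (f x)) @ F --> row i M.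
Proof.
move=> /cvg_mxP fM; apply/cvg_mxP => a j; rewrite mxE.
under eq_cvg do rewrite mxE.
exact: fM.
Qed.

Lemma cvg_dotv k (f g : T -> 'rV[R]_k) (u v : 'rV[R]_k) :
  f @ F --> u -> g @ F --> v -> (fun x => dotv (f x) (g x)) @ F --> dotv u v.
Proof.
move=> /cvg_mxP fu /cvg_mxP gv; rewrite /dotv.
by apply: cvg_sumr => i; apply: cvgM.
Qed.

Lemma cvg_det n (f : T -> 'M[R]_n) (M : 'M[R]_n) :
  f @ F --> M -> (fun x => \det (f x)) @ F --> \det M.
Proof.
move=> /cvg_mxP fM; apply: cvg_sumr => s; apply: cvgM; first exact: cvg_cst.
exact: cvg_prodr.
Qed.

Lemma cvg_adj n (f : T -> 'M[R]_n) (M : 'M[R]_n) :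
  f @ F --> M -> (fun x => \adj (f x)) @ F --> \adj M.
Proof.
move=> /cvg_mxP fM; apply/cvg_mxP => i j; rewrite mxE.
under eq_cvg do rewrite mxE.
apply: cvgM; first exact: cvg_cst.
apply: cvg_det; apply/cvg_mxP => a b; rewrite !mxE.
under eq_cvg do rewrite !mxE.
exact: fM.
Qed.

(** [invmx] returns its argument when this is singular; a nonzero limit determinant keeps [f x]
    invertible eventually, where the cofactor formula applies. *)
Lemma cvg_invmx n (f : T -> 'M[R]_n) (M : 'M[R]_n) :
  M \in unitmx -> f @ F --> M -> (fun x => invmx (f x)) @ F --> invmx M.
Proof.
move=> Mu fM; have detM0 : \det M != 0 by rewrite -unitfE.
have fu : \forall x \near F, f x \in unitmx.
  apply: filterS (cvgr_neq0 _ (cvg_det fM) detM0) => x.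
  by rewrite unitmxE unitfE.
rewrite {2}/invmx Mu.
have : (fun x => (\det (f x))^-1 *: \adj (f x)) @ F --> (\det M)^-1 *: \adj M.
  apply: cvgZ; last exact: cvg_adj.
  by apply: cvgV => //; exact: cvg_det.
apply: cvg_trans; apply: near_eq_cvg.
by apply: filterS fu => x xu; rewrite /invmx xu.
Qed.

End matrix_limits.

Lemma is_derive_coord (R : realType) (V : normedModType R) m n
    (f : V -> 'M[R]_(m, n)) (x v : V) (df : 'M[R]_(m, n)) i j :
  is_derive x v f df -> is_derive x v (fun y => f y i j) (df i j).
Proof.
move=> [dfx <-]; split; first exact: (derivable_mxP _ _ _).1.
by rewrite derive_mx// mxE.
Qed.

Lemma is_derive_dotv (R : realType) (V : normedModType R) k
    (f g : V -> 'rV[R]_k) (x v : V) (df dg : 'rV[R]_k) :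
  is_derive x v f df -> is_derive x v g dg ->
  is_derive x v (fun y => dotv (f y) (g y)) (dotv (f x) dg + dotv df (g x)).
Proof.
move=> fx gx.
have := is_derive_sum (fun i => is_deriveM (is_derive_coord 0 i fx)
  (is_derive_coord 0 i gx)).
have -> : \sum_(i < k) ((fun y => f y 0 i) * (fun y => g y 0 i)) =
    (fun y => dotv (f y) (g y)).
  by apply/funext => y; rewrite fct_sumE.
move=> H; apply: (is_derive_eq H); rewrite /dotv -big_split/=.
apply: eq_bigr => i _.
by rewrite [_ *: _]mulrC [X in _ + X]mulrC [_ * dg _ _]mulrC.
Qed.

(** * Hopf's barrier function *)

Section barrier.
Context {R : realType} {n : nat} (K r : R) (c : 'rV[R]_n).

Let s (x : 'rV[R]_n) : R := r - dotv (x - c) (x - c).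

(** Up to a constant factor, the second-order truncation of Hopf's exponential barrier
    [exp (2 * K * s) - 1]; [r] is the squared radius. *)
Definition barrier (x : 'rV[R]_n) : R := s x + K * (s x * s x).

Lemma is_derive_subr_cst (x v : 'rV[R]_n) :
  is_derive x v (fun y => y - c) v.
Proof.
have := is_deriveB (is_derive_id x v) (is_derive_cst c x v).
by rewrite subr0.
Qed.

Let is_derive_s (x v : 'rV[R]_n) : is_derive x v s (- 2 * dotv (x - c) v).
Proof.
have H := is_derive_dotv (is_derive_subr_cst x v) (is_derive_subr_cst x v).
apply: (is_derive_eq (is_deriveB (is_derive_cst r x v) H)).
by rewrite sub0r (dotvC v) mulNr mulrDl mul1r.
Qed.

Lemma is_derive_barrier (x v : 'rV[R]_n) :
  is_derive x v barrier ((1 + 2 * K * s x) * (- 2 * dotv (x - c) v)).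
Proof.
have sx := is_derive_s x v.
apply: (is_derive_eq (is_deriveD sx (is_deriveZ K (is_deriveM sx sx)))).
by rewrite /GRing.scale/=; ring.
Qed.

Lemma derive_barrier (v : 'rV[R]_n) : 'D_v barrier =
  (fun x => (1 + 2 * K * s x) * (- 2 * dotv (x - c) v)).
Proof. by apply/funext => x; exact: (is_deriveE (is_derive_barrier x v)). Qed.

(** On the sphere [s x = 0] only the square term involves [K], so a large [K] makes it dominate in
    every direction not tangent to the sphere. *)
Lemma is_derive2_barrier (x v : 'rV[R]_n) :
  is_derive x v ('D_v barrier)
    (8 * K * dotv (x - c) v ^+ 2 - 2 * (1 + 2 * K * s x) * dotv v v).
Proof.
rewrite derive_barrier; have sx := is_derive_s x v.
have H1 := is_deriveD (is_derive_cst (1 : R) x v) (is_deriveZ (2 * K) sx).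
have H2 := is_deriveZ (- 2) (is_derive_dotv (is_derive_subr_cst x v)
  (is_derive_cst v x v)).
apply: (is_derive_eq (is_deriveM H1 H2)).
rewrite /=.
rewrite (_ : dotv _ 0 = 0); last by rewrite -(scale0r v) dotvZr mul0r.
rewrite (_ : (_ + _ : _ -> _) x = 1 + 2 * K * s x)// /GRing.scale/=; ring.
Qed.

End barrier.

Section barrier_limits.
Context {R : realType} {n : nat} {T : Type} {F : set_system T} {FF : Filter F}.

Lemma cvg_dotv_dist (c : 'rV[R]_n) (f : T -> 'rV[R]_n) (a : 'rV[R]_n) :
  f @ F --> a ->
  (fun x => dotv (f x - c) (f x - c)) @ F --> dotv (a - c) (a - c).
Proof.
by move=> fa; apply: cvg_dotv; apply: cvgB => //; exact: cvg_cst.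
Qed.

Lemma cvg_sqr_dist (r : R) (c : 'rV[R]_n) (f : T -> 'rV[R]_n) (a : 'rV[R]_n) :
  f @ F --> a ->
  (fun x => r - dotv (f x - c) (f x - c)) @ F --> r - dotv (a - c) (a - c).
Proof.
by move=> fa; apply: cvgB; [exact: cvg_cst|exact: cvg_dotv_dist].
Qed.

Lemma cvg_barrier (K r : R) (c : 'rV[R]_n) (f : T -> 'rV[R]_n) (a : 'rV[R]_n) :
  f @ F --> a -> (fun x => barrier K r c (f x)) @ F --> barrier K r c a.
Proof.
move=> fa; have cs := @cvg_sqr_dist r c _ _ fa.
by apply: cvgD => //; apply: cvgM; [exact: cvg_cst|exact: cvgM].
Qed.

End barrier_limits.

(** * Elliptic operators and the strong minimum principle *)

Section elliptic_operator.
Context {R : realType} {n k : nat}.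
Implicit Types (w : 'rV[R]_n -> R).

(** Each direction [row l (sigma x)] is frozen at [x], so the leading part is the Hessian traced
    against [(sigma x)^T *m sigma x]; only pure second derivatives along lines occur. *)
Definition elliptic_op (sigma : 'rV[R]_n -> 'M[R]_(k, n))
    (beta : 'rV[R]_n -> 'rV[R]_n) w (x : 'rV[R]_n) : R :=
  \sum_(l < k) 'D_(row l (sigma x)) ('D_(row l (sigma x)) w) x
  + 'D_(beta x) w x.

Variables (sigma : 'rV[R]_n -> 'M[R]_(k, n)) (beta : 'rV[R]_n -> 'rV[R]_n).
Local Notation L := (elliptic_op sigma beta).

Lemma elliptic_op_local_min w q :
  (\forall x \near q, w q <= w x) ->
  (\forall x \near q, forall v, derivable w x v) ->
  (forall v, derivable ('D_v w) q v) -> 0 <= L w q.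
Proof.
move=> qmin dw ddw.
have H v : 'D_v w q = 0 /\ 0 <= 'D_v ('D_v w) q.
  by apply: local_min_derive2 => //; apply: filterS dw => x.
rewrite /elliptic_op (H _).1 addr0; apply: sumr_ge0 => l _; exact: (H _).2.
Qed.

Lemma elliptic_opB w h (e : R) q :
  (\forall x \near q, forall v, derivable w x v) ->
  (\forall x \near q, forall v, derivable h x v) ->
  (forall v, derivable ('D_v w) q v) -> (forall v, derivable ('D_v h) q v) ->
  L (w - e *: h) q = L w q - e * L h q.
Proof.
move=> dw dh ddw ddh.
have E : \forall x \near q, forall v,
    'D_v (w - e *: h) x = ('D_v w - e *: 'D_v h) x.
  apply: filterS2 dw dh => x dwx dhx v.
  by rewrite deriveB//; [rewrite deriveZ|exact: derivableZ].
rewrite /elliptic_op.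
have -> : 'D_(beta q) (w - e *: h) q = 'D_(beta q) w q - e * 'D_(beta q) h q.
  by rewrite (nbhs_singleton E).
rewrite mulrDr opprD addrACA; congr (_ + _).
rewrite mulr_sumr -sumrB; apply: eq_bigr => l _; set v := row l _.
have -> : 'D_v ('D_v (w - e *: h)) q = 'D_v ('D_v w - e *: 'D_v h) q.
  by apply: near_eq_derive; apply: filterS E => x; exact.
by rewrite deriveB//; [rewrite deriveZ|exact: derivableZ].
Qed.

(* Near a zero [z] of [w] on the sphere of centre [c] through [z], the barrier
   is a strict subsolution for [K] large, positive exactly inside the sphere, so
   [w - e * barrier] has an interior local minimum for [e] small. *)
Lemma no_touching_sphere w z c :
  (\forall x \near z, differentiable w x) ->
  (\forall x \near z, forall v, derivable ('D_v w) x v) ->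
  {for z, continuous sigma} -> {for z, continuous beta} ->
  sigma z *m (z - c)^T != 0 ->
  (\forall x \near z, L w x <= 0) ->
  w z = 0 -> (\forall x \near z, 0 <= w x) ->
  (\forall x \near z, x != z ->
     dotv (x - c) (x - c) <= dotv (z - c) (z - c) -> 0 < w x) -> False.
Proof.
move=> dw ddw csigma cbeta sigma0 Lw wz wge0 wgt0.
set r := dotv (z - c) (z - c).
pose s x := r - dotv (x - c) (x - c).
have cs (x : 'rV[R]_n) : {for x, continuous s}.
  exact: (@cvg_sqr_dist R n _ (nbhs x) _ r c id x cvg_id).
have sz : s z = 0 by rewrite /s subrr.
(* The squared length of [sigma z *m (z - c)^T], positive because the sphere is non-characteristic
   at [z]. *)
pose Q := \sum_(l < k) dotv (z - c) (row l (sigma z)) ^+ 2.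
have Q0 : 0 < Q.
  rewrite (_ : Q = dotv (sigma z *m (z - c)^T)^T (sigma z *m (z - c)^T)^T).
    by apply: dotv_gt0; rewrite -(inj_eq trmx_inj) trmxK trmx0.
  apply: eq_bigr => l _; rewrite !mxE expr2 /dotv.
  by congr (_ * _); apply: eq_bigr => i _; rewrite !mxE mulrC.
pose P := \sum_(l < k) dotv (row l (sigma z)) (row l (sigma z))
  + dotv (z - c) (beta z).
(* Since [s z = 0], [L h z = 8 * K * Q - 2 * P], and this [K] makes it at least [2]. *)
pose K := (`|P| + 1) / (4 * Q).
have K0 : 0 < K by rewrite divr_gt0 ?ltr_wpDl// mulr_gt0.
pose h := barrier K r c.
have dh x v : derivable h x v.
  exact: (is_derive_derivable (is_derive_barrier K r c x v)).
have ddh x v : derivable ('D_v h) x v.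
  exact: (is_derive_derivable (is_derive2_barrier K r c x v)).
have LhE x : L h x = \sum_(l < k) (8 * K * dotv (x - c) (row l (sigma x)) ^+ 2
      - 2 * (1 + 2 * K * s x) * dotv (row l (sigma x)) (row l (sigma x)))
    + (1 + 2 * K * s x) * (- 2 * dotv (x - c) (beta x)).
  rewrite /elliptic_op (is_deriveE (is_derive_barrier K r c _ _)).
  congr (_ + _); apply: eq_bigr => l _.
  exact: (is_deriveE (is_derive2_barrier K r c _ _)).
have Lhz : 0 < L h z.
  rewrite LhE sz mulr0 addr0 mulr1 mul1r sumrB -!mulr_sumr -/Q.
  have -> : 8 * K * Q = 2 * (`|P| + 1).
    by rewrite /K; field; rewrite gt_eqF.
  by have := ler_norm P; rewrite /P; lra.
have c1 (t : R) (F : set_system 'rV[R]_n) : Filter F -> id @ F --> z ->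
    (fun x => 1 + t * s x) @ F --> 1 + t * s z.
  move=> FF cF; apply: cvgD; first exact: cvg_cst.
  by apply: cvgM; [exact: cvg_cst|exact: (@cvg_sqr_dist R n _ F _ r c id z)].
have Lh : \forall x \near z, 0 < L h x.
  have cLh (F : set_system 'rV[R]_n) : Filter F -> sigma @ F --> sigma z ->
      beta @ F --> beta z -> id @ F --> z -> L h @ F --> L h z.
    move=> FF csF cbF cF; rewrite (LhE z) (funext LhE).
    have cxc : (fun x : 'rV[R]_n => x - c) @ F --> z - c.
      by apply: cvgB => //; exact: cvg_cst.
    have crow l : (fun x => row l (sigma x)) @ F --> row l (sigma z).
      exact: cvg_row.
    have cK := c1 (2 * K) F FF cF.
    apply: cvgD; last first.
      by apply: cvgM => //; apply: cvgM; [exact: cvg_cst|exact: cvg_dotv].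
    apply: cvg_sumr => l; apply: cvgB.
      apply: cvgM; [exact: cvg_cst|rewrite expr2].
      by under eq_cvg do rewrite expr2; apply: cvgM; exact: cvg_dotv.
    by apply: cvgM; [apply: cvgM => //; exact: cvg_cst|exact: cvg_dotv].
  have cLhz := cLh _ (nbhs_filter z) csigma cbeta (@cvg_id _ (nbhs z)).
  exact: cvgr_gt cLhz _ Lhz.
(* Makes [h = s * (1 + K * s)] have the sign of [s] near [z]. *)
have Ks : \forall x \near z, 0 < 1 + K * s x.
  have cK := c1 K _ (nbhs_filter z) (@cvg_id _ (nbhs z)).
  by apply: cvgr_gt cK _ _; rewrite sz mulr0 addr0.
have cdist (F : set_system 'rV[R]_n) (a : 'rV[R]_n) : Filter F ->
    id @ F --> a -> (fun x => `|z - x|) @ F --> `|z - a|.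
  by move=> FF cF; apply: cvg_norm; apply: cvgB => //; exact: cvg_cst.
pose good x := [/\ differentiable w x, forall v, derivable ('D_v w) x v,
  L w x <= 0, 0 <= w x & x != z -> dotv (x - c) (x - c) <= r -> 0 < w x]
  /\ (0 < L h x /\ 0 < 1 + K * s x).
have /nbhs_closedballP[d Hd] : \forall x \near z, good x.
  by near=> x; split; split; near: x.
pose B := closed_ball z d%:num.
have BE x : B x <-> `|z - x| <= d%:num.
  by rewrite /B closed_ballE.
have cB : compact B.
  apply: bounded_closed_compact; last exact: closed_ball_closed.
  exists (`|z| + d%:num); split; first by rewrite num_real.
  move=> M HM x /BE Bx; apply/ltW; apply: le_lt_trans HM.
  by rewrite -(subKr z x) (le_trans (ler_normB _ _))// lerD2l.
have BP x : B x -> good x by move/Hd.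
have hcont x : {for x, continuous h}.
  exact: (@cvg_barrier R n _ (nbhs x) _ K r c id x cvg_id).
have wcont x : B x -> {for x, continuous w}.
  by move=> /BP[[wx _ _ _ _] _]; exact: differentiable_continuous.
have hE x : h x = s x * (1 + K * s x) by rewrite /h /barrier -/(s x); ring.
have [e e0 He] : exists2 e, 0 < e & forall x, B x -> `|z - x| = d%:num ->
    0 <= s x -> e * h x < w x.
  (* The boundary part of [B] inside or on the sphere through [z]: compact and away from [z], so [w]
     is bounded below there by a positive constant. *)
  pose A := B `&` ([set x | `|z - x| = d%:num] `&` [set x | 0 <= s x]).
  have cA : compact A.
    apply: compact_closedI => //; apply: closedI.
      have -> : [set x | `|z - x| = d%:num] =
          (fun x => `|z - x|) @^-1` [set d%:num] by [].
      apply: preimage_closed; last exact: closed_eq.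
      by move=> x _; exact: cdist (nbhs_filter x) (@cvg_id _ (nbhs x)).
    have -> : [set x | 0 <= s x] = s @^-1` [set t | 0 <= t] by [].
    apply: preimage_closed; last exact: closed_ge.
    by move=> x _; exact: cs.
  have [A0|/set0P/negP/negbNE/eqP A0] := pselect (A !=set0); last first.
    exists 1 => // x Bx xd sx; suff : A x by rewrite A0.
    by split.
  have [a Aa amin] := compact_argmin A0 cA (fun x Ax => wcont x Ax.1).
  have [b Ab bmax] :=
    compact_argmin A0 cA (fun x Ax => @cvgN _ _ _ _ _ _ _ (hcont x)).
  have wa : 0 < w a.
    have [[_ _ _ _ H] _] := BP _ Aa.1; apply: H.
      apply: contra_eq_neq Aa.2.1 => ->; rewrite subrr normr0 lt_eqF//.
    by have := Aa.2.2; rewrite /= /s subr_ge0.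
  (* [a] minimises [w] and [b] maximises [h] on [A]; the [+ 1] keeps the denominator positive and
     the bound strict. *)
  exists (w a / (`|h b| + 1)); first by rewrite divr_gt0// ltr_wpDl.
  move=> x Bx xd sx; apply: (@lt_le_trans _ _ (w a)); last first.
    by apply: amin; split.
  rewrite mulrAC ltr_pdivrMr ?ltr_wpDl// ltr_pM2l//.
  have := bmax x; rewrite lerN2 => /(_ _)/le_lt_trans; apply; first by split.
  by rewrite (le_lt_trans (ler_norm _))// ltrDl.
pose f := w - e *: h.
have [q Bq qmin] : exists2 q, B q & forall x, B x -> f q <= f x.
  apply: compact_argmin => //.
    by exists z; apply/BE; rewrite subrr normr0.
  move=> x Bx; have cf (F : set_system 'rV[R]_n) : Filter F ->
      w @ F --> w x -> h @ F --> h x -> f @ F --> f x.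
    by move=> FF wF hF; apply: cvgB => //; apply: cvgZ => //; exact: cvg_cst.
  by apply: cf (nbhs_filter x) _ _; [exact: wcont|exact: hcont].
have fq0 : f q <= 0.
  have := qmin z; have -> : f z = 0.
    by rewrite /f /= !fctE wz hE sz mul0r scaler0 subrr.
  by apply; apply/BE; rewrite subrr normr0.
have fE x : f x = w x - e * h x by [].
have [[_ ddwq Lwq wq _] [Lhq Ksq]] := BP _ Bq.
(* On the boundary of [B], [f] is positive: by the choice of [e] where [s >= 0], and because
   [h < 0 <= w] where [s < 0]. So the minimiser is interior. *)
have qint : `|z - q| < d%:num.
  rewrite lt_neqAle (iffLR (BE q) Bq) andbT; apply/negP => /eqP qd.
  have [sq|sq] := leP 0 (s q).
    by move: fq0; rewrite fE subr_le0 leNgt He.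
  move: fq0; rewrite fE subr_le0 leNgt; apply/negP/negPn.
  by apply: lt_le_trans wq; rewrite pmulr_rlt0// hE pmulr_llt0.
have nearq : \forall x \near q, B x.
  have : \forall x \near q, `|z - x| < d%:num.
    exact: cvgr_lt (cdist _ q (nbhs_filter q) (@cvg_id _ (nbhs q))) _ qint.
  by apply: filterS => x /ltW/BE.
have dwq : \forall x \near q, forall v, derivable w x v.
  by apply: filterS nearq => x /BP[[dx _ _ _ _] _] v; exact: diff_derivable.
have : 0 <= L f q.
  apply: elliptic_op_local_min.
  - by apply: filterS nearq => x; exact: qmin.
  - by apply: filterS dwq => x dx v; apply: derivableB => //; exact: derivableZ.
  - move=> v; have E : \forall x \near q,
        ('D_v w - e *: 'D_v h) x = 'D_v f x.
      apply: filterS dwq => x dx.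
      by rewrite deriveB//; [rewrite deriveZ|exact: derivableZ].
    by apply: (near_eq_derivable E); apply: derivableB => //; exact: derivableZ.
have dhq : \forall x \near q, forall v, derivable h x v by near=> x; exact: dh.
(* At this interior minimum [0 <= L f q], yet [L f q = L w q - e * L h q < 0]. *)
rewrite (elliptic_opB e dwq dhq ddwq (ddh q)).
by rewrite leNgt subr_lt0 (le_lt_trans Lwq)// mulr_gt0.
Unshelve. all: by end_near. Qed.

End elliptic_operator.

(* The zero [z] of [w] closest to a point [y] where [w > 0] lies on a sphere
   about the midpoint of [y] and [z] that touches the zero set only at [z]. *)
Lemma strong_minimum_principle (R : realType) (n k : nat)
    (sigma : 'rV[R]_n -> 'M[R]_(k, n)) (beta : 'rV[R]_n -> 'rV[R]_n)
    (U : set 'rV[R]_n) (w : 'rV[R]_n -> R) (x0 : 'rV[R]_n) :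
  open U -> (forall x, U x -> differentiable w x) ->
  (forall v x, U x -> derivable ('D_v w) x v) ->
  (forall x, U x -> {for x, continuous sigma}) ->
  (forall x, U x -> {for x, continuous beta}) ->
  (forall x, U x -> row_full (sigma x)) ->
  (forall x, U x -> 0 <= w x) ->
  (forall x, U x -> elliptic_op sigma beta w x <= 0) ->
  U x0 -> w x0 = 0 -> \forall x \near x0, w x = 0.
Proof.
move=> oU dw ddw csigma cbeta fsigma wge0 Lw Ux0 wx0.
have nU x : U x -> \forall y \near x, U y by move=> Ux; exact: open_nbhs_nbhs.
have wcont x : U x -> {for x, continuous w}.
  by move=> /dw wx; exact: differentiable_continuous.
have [d Hd] : exists d : {posnum R}, closed_ball x0 d%:num `<=` U.
  by have /nbhs_closedballP := nU _ Ux0.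
pose B := closed_ball x0 d%:num.
have BE x : B x <-> `|x0 - x| <= d%:num by rewrite /B closed_ballE.
pose Z := B `&` [set x | w x = 0].
have Zx0 : Z x0 by split=> //; apply/BE; rewrite subrr normr0.
have cB : compact B.
  apply: bounded_closed_compact; last exact: closed_ball_closed.
  exists (`|x0| + d%:num); split; first by rewrite num_real.
  move=> M HM x /BE Bx; apply/ltW; apply: le_lt_trans HM.
  by rewrite -(subKr x0 x) (le_trans (ler_normB _ _))// lerD2l.
have cZ : compact Z.
  apply: subclosed_compact cB _; last by move=> x [].
  move=> x clx; have Bx : B x.
    apply: closed_ball_closed => A Ax.
    by have [y [[By _] Ay]] := clx A Ax; exists y.
  split=> //; apply/eqP; apply: contraT => /eqP/eqP wx0'.
  have [y [[_ /= wy0]]] := clx _ (cvgr_neq0 _ (wcont x (Hd _ Bx)) wx0').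
  by rewrite /= wy0 eqxx.
have cdist (y x : 'rV[R]_n) : {for x, 
    continuous (fun t : 'rV[R]_n => dotv (t - y) (t - y))}.
  exact: (@cvg_dotv_dist R n _ (nbhs x) _ y id x cvg_id).
(* Half the radius leaves room: a point as close to [y] as its nearest zero [z] lies within [d] of
   [x0], hence in [B]. *)
have ynear : \forall y \near x0,
    U y /\ dotv (y - x0) (y - x0) < (d%:num / 2) ^+ 2.
  near=> y; split; first by near: y; exact: nU.
  near: y; apply: cvgr_lt (cdist x0 x0) _ _.
  by rewrite subrr -(scale0r (x0 : 'rV[R]_n)) dotvZl mul0r exprn_gt0.
apply: filterS ynear => y [Uy yd].
apply/eqP; apply: contraT => wy0.
have [z Zz zmin] : exists2 z, Z z & forall x, Z x ->
    dotv (z - y) (z - y) <= dotv (x - y) (x - y).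
  by apply: compact_argmin => //; exists x0.
have half_norm (u : 'rV[R]_n) :
    dotv u u < (d%:num / 2) ^+ 2 -> `|u| < d%:num / 2.
  move=> ud; rewrite -(@ltr_pXn2r _ 2)// ?nnegrE//.
  exact: le_lt_trans (sqr_norm_le_dotv u) ud.
have x0y : dotv (x0 - y) (x0 - y) = dotv (y - x0) (y - x0).
  by rewrite -opprB dotvNl dotvNr opprK.
have inB (x : 'rV[R]_n) :
    dotv (x - y) (x - y) <= dotv (z - y) (z - y) -> `|x0 - x| < d%:num.
  move=> xz; have xd : `|x - y| < d%:num / 2.
    apply: half_norm; apply: le_lt_trans yd; apply: le_trans xz _.
    by rewrite -x0y; exact: zmin.
  have -> : x0 - x = (x0 - y) - (x - y) by rewrite opprB addrC subrKA addrC.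
  apply: le_lt_trans (ler_normB _ _) _; rewrite (splitr d%:num) ltrD//.
  by apply: half_norm; rewrite x0y.
have Uz : U z by exact/Hd/Zz.1.
pose c := 2^-1 *: (y + z).
have zc : z - c = 2^-1 *: (z - y).
  by apply/rowP => i; rewrite !mxE; field.
have zy0 : z - y != 0.
  by rewrite subr_eq0; apply: contraNneq wy0 => <-; apply/eqP; exact: Zz.2.
exfalso; apply: (@no_touching_sphere _ _ _ sigma beta w z c).
- by apply: filterS (nU _ Uz) => x; exact: dw.
- by apply: filterS (nU _ Uz) => x Ux v; exact: ddw.
- exact: csigma.
- exact: cbeta.
- have /row_fullP[N Ns] := fsigma _ Uz.
  apply: contra_neq zy0 => /(congr1 (mulmx N)).
  rewrite mulmxA Ns mul1mx mulmx0 zc => /(congr1 trmx); rewrite trmxK trmx0.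
  by move/eqP; rewrite scaler_eq0 invr_eq0 pnatr_eq0/= => /eqP.
- by apply: filterS (nU _ Uz) => x; exact: Lw.
- exact: Zz.2.
- by apply: filterS (nU _ Uz) => x; exact: wge0.
have : \forall x \near z, U x := nU _ Uz.
apply: filterS => x Ux xz xc.
(* Apollonius' identity for the median from [x] to the midpoint [c]. With [e2], a point [x] other
   than [z] inside the sphere about [c] is strictly closer to [y] than [z], so it cannot be a zero
   of [w]. *)
have e1 : dotv (x - y) (x - y) + dotv (x - z) (x - z) =
    2 * dotv (x - c) (x - c) + 2 * dotv (z - c) (z - c).
  rewrite /dotv !mulr_sumr -!big_split/=; apply: eq_bigr => i _.
  by rewrite !mxE; field.
have e2 : dotv (z - y) (z - y) = 4 * dotv (z - c) (z - c).
  by rewrite zc dotvZl dotvZr; field.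
have xz0 : 0 < dotv (x - z) (x - z) by rewrite dotv_gt0// subr_eq0.
have xyz : dotv (x - y) (x - y) < dotv (z - y) (z - y) by rewrite e2; lra.
rewrite lt_def wge0// andbT; apply/eqP => wx.
have : dotv (z - y) (z - y) <= dotv (x - y) (x - y).
  by apply: zmin; split=> //; apply/BE/ltW/inB/ltW.
by rewrite leNgt xyz.
Unshelve. all: by end_near. Qed.

(** * Derivatives of the squared norm and projections, for an immersion in coordinates *)

Section euclidean_immersion.
Context {R : realType} {n k : nat} (F : 'rV[R]_n -> 'rV[R]_k).
Implicit Types x v : 'rV[R]_n.

Lemma derive_jac x v : differentiable F x -> 'D_v F x = v *m jac F x.
Proof.
move=> dF; rewrite deriveE// [in LHS](row_sum_delta v) linear_sum mulmx_sum_row.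
by apply: eq_bigr => i _; rewrite linearZ/= rowK -deriveE.
Qed.

Lemma is_derive_sqr_norm x v : differentiable F x ->
  is_derive x v (fun y => dotv (F y) (F y)) (2 * dotv (F x) ('D_v F x)).
Proof.
move=> dF; have dFv : is_derive x v F ('D_v F x).
  by apply: derivableP; exact: diff_derivable.
apply: (is_derive_eq (is_derive_dotv dFv dFv)).
by rewrite (dotvC ('D_v F x)) mulrDl mul1r.
Qed.

Lemma differentiable_sqr_norm x : differentiable F x ->
  differentiable (fun y => dotv (F y) (F y)) x.
Proof.
move=> dF; have dFi i : differentiable (fun y => F y 0 i) x.
  exact: (differentiable_comp dF (differentiable_coord _ _ _)).
have -> : (fun y => dotv (F y) (F y)) =
    \sum_(i < k) ((fun y => F y 0 i) * (fun y => F y 0 i)).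
  by apply/funext => y; rewrite fct_sumE.
by apply: differentiable_sum => i; exact: differentiableM.
Qed.

Lemma is_derive2_sqr_norm x v : (\forall y \near x, differentiable F y) ->
  differentiable ('D_v F) x ->
  is_derive x v ('D_v (fun y => dotv (F y) (F y)))
    (2 * (dotv ('D_v F x) ('D_v F x) + dotv (F x) ('D_v ('D_v F) x))).
Proof.
move=> dF ddF.
have E : \forall y \near x, (2 \*: (fun y => dotv (F y) ('D_v F y))) y =
    'D_v (fun y => dotv (F y) (F y)) y.
  apply: filterS dF => y dFy.
  by rewrite (is_deriveE (is_derive_sqr_norm v dFy)).
apply: (near_eq_is_derive E).
have dFv : is_derive x v F ('D_v F x).
  by apply: derivableP; apply: diff_derivable; exact: nbhs_singleton dF.
have ddFv : is_derive x v ('D_v F) ('D_v ('D_v F) x).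
  by apply: derivableP; exact: diff_derivable.
apply: (is_derive_eq (is_deriveZ 2 (is_derive_dotv dFv ddFv))).
by rewrite /GRing.scale/= addrC.
Qed.

(** Linearity of the differential, used on [F] near [x] and then on its partial derivatives, relates
    second derivatives along a line to the [partial2] entering the mean curvature. *)
Lemma derive2_partial2 x v : (\forall y \near x, differentiable F y) ->
  (forall v, differentiable ('D_v F) x) ->
  'D_v ('D_v F) x =
  \sum_(i < n) \sum_(j < n) (v 0 i * v 0 j) *: partial2 F i j x.
Proof.
move=> dF ddF.
have E : \forall y \near x, 'D_v F y =
    (\sum_(j < n) (v 0 j \*: 'D_(basis_vec R j) F)) y.
  apply: filterS dF => y dFy; rewrite derive_jac// mulmx_sum_row fct_sumE.
  by apply: eq_bigr => j _; rewrite rowK.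
rewrite (near_eq_derive v E) derive_sum; last first.
  by move=> j; apply: derivableZ; exact: diff_derivable.
rewrite exchange_big/=; apply: eq_bigr => j _.
rewrite deriveZ; last exact: diff_derivable.
have -> : 'D_v ('D_(basis_vec R j) F) x =
    \sum_(i < n) v 0 i *: partial2 F i j x.
  rewrite deriveE// [in LHS](row_sum_delta v) linear_sum.
  by apply: eq_bigr => i _; rewrite linearZ/= -deriveE.
by rewrite scaler_sumr; apply: eq_bigr => i _; rewrite scalerA mulrC.
Qed.

End euclidean_immersion.

Section projection.
Context {R : realType} {l k : nat} (A : 'M[R]_(l, k)).

Lemma normal_part_sum (I : finType) (v : I -> 'rV[R]_k) (a : I -> R) :
  \sum_i a i *: normal_part A (v i) = normal_part A (\sum_i a i *: v i).
Proof.
rewrite /normal_part !mulmx_suml -sumrB; apply: eq_bigr => i _.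
by rewrite scalerBr -!scalemxAl.
Qed.

Lemma gram_sym : (A *m A^T)^T = A *m A^T.
Proof. by rewrite trmx_mul trmxK. Qed.

Lemma invmx_gram_sym : (invmx (A *m A^T))^T = invmx (A *m A^T).
Proof. by rewrite trmx_inv gram_sym. Qed.

(** For independent rows this is [A^T *m invmx (A *m A^T)]: row [a] holds the coordinates of the
    tangential part of the [a]-th standard vector. It factors the inverse metric rationally in [A],
    avoiding matrix square roots. *)
Definition coframe : 'M[R]_(k, l) := (invmx (A *m A^T) *m A)^T.

Lemma coframe_gram : A *m A^T \in unitmx ->
  coframe^T *m coframe = invmx (A *m A^T).
Proof.
move=> gu; rewrite /coframe trmxK trmx_mul invmx_gram_sym mulmxA.
by rewrite -(mulmxA (invmx _) A) mulVmx// mul1mx.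
Qed.

Lemma row_full_coframe : A *m A^T \in unitmx -> row_full coframe.
Proof.
move=> gu; apply/row_fullP; exists A.
by rewrite /coframe trmx_mul invmx_gram_sym mulmxA mulmxV.
Qed.

(** Summing over the ambient index contracts two coframes into the inverse Gram matrix: a sum over
    rows becomes a metric trace. *)
Lemma sum_coframe (M : 'M[R]_l) : A *m A^T \in unitmx ->
  \sum_i (row i coframe *m M *m (row i coframe)^T) 0 0 =
  \sum_i \sum_j invmx (A *m A^T) i j * M i j.
Proof.
move=> gu; rewrite -coframe_gram//.
transitivity (\sum_a \sum_i \sum_j coframe a i * coframe a j * M i j).
  apply: eq_bigr => a _; rewrite mxE exchange_big/=; apply: eq_bigr => j _.
  rewrite !mxE mulr_suml; apply: eq_bigr => i _; rewrite !mxE; ring.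
rewrite exchange_big/=; apply: eq_bigr => i _.
rewrite exchange_big/=; apply: eq_bigr => j _.
by rewrite mxE mulr_suml; apply: eq_bigr => a _; rewrite !mxE.
Qed.

End projection.

(** * The drift Laplacian of a self-shrinker in a chart *)

Section drift_laplacian.
Context {R : realType} {n k : nat} (F : 'rV[R]_n -> 'rV[R]_k) (lambda : R).

Let gram (x : 'rV[R]_n) : 'M[R]_n := jac F x *m (jac F x)^T.

Definition hess_trace (x : 'rV[R]_n) : 'rV[R]_k :=
  \sum_(i < n) \sum_(j < n) invmx (gram x) i j *: partial2 F i j x.

(** Coordinates of minus the tangential part of [hess_trace x + lambda *: F x]. The first summand
    supplies the Christoffel term of the Laplace-Beltrami operator, the second the drift along the
    position vector. *)
Definition shrinker_drift (x : 'rV[R]_n) : 'rV[R]_n :=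
  - ((hess_trace x + lambda *: F x) *m (jac F x)^T *m invmx (gram x)).

Definition drift_laplacian : ('rV[R]_n -> R) -> 'rV[R]_n -> R :=
  elliptic_op (fun x => coframe (jac F x)) shrinker_drift.

(* For a self-shrinker the drift cancels the tangential parts, which leaves the
   familiar [L |F|^2 = 2 (n - lambda |F|^2)]. *)
Lemma drift_laplacian_sqr_norm x :
  (\forall y \near x, differentiable F y) ->
  (forall v, differentiable ('D_v F) x) ->
  gram x \in unitmx ->
  \sum_(i < n) \sum_(j < n)
    invmx (gram x) i j *: normal_part (jac F x) (partial2 F i j x) =
    - (lambda *: normal_part (jac F x) (F x)) ->
  drift_laplacian (fun y => dotv (F y) (F y)) x =
    2 * (n%:R - lambda * dotv (F x) (F x)).
Proof.
move=> dF ddF gu H; have dFx := nbhs_singleton dF.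
rewrite /drift_laplacian /elliptic_op; set A := jac F x.
rewrite (is_deriveE (is_derive_sqr_norm _ dFx)) derive_jac// -/A.
under eq_bigr => l _.
  rewrite (is_deriveE (is_derive2_sqr_norm dF (ddF _))).
  rewrite derive_jac// -/A derive2_partial2//.
  over.
rewrite -mulr_sumr -mulrDr big_split/=; congr (2 * _).
(* The squared first derivatives sum to the trace of the inverse Gram matrix times the Gram
   matrix. *)
have -> : \sum_(l < k) dotv (row l (coframe A) *m A) (row l (coframe A) *m A) =
    n%:R.
  under eq_bigr => l _.
    rewrite dotvE trmx_mul mulmxA -(mulmxA _ A) -/(gram x).
    over.
  rewrite sum_coframe//.
  transitivity (\tr (invmx (gram x) *m gram x)).
    apply: eq_bigr => i _; rewrite mxE; apply: eq_bigr => j _.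
    by congr (_ * _); have /matrixP/(_ j i) := gram_sym A; rewrite mxE.
  by rewrite mulVmx// mxtrace1.
have -> : \sum_(l < k) dotv (F x) (\sum_(i < n) \sum_(j < n)
    (row l (coframe A) 0 i * row l (coframe A) 0 j) *: partial2 F i j x) =
    dotv (F x) (hess_trace x).
  rewrite -dotv_sumr; congr dotv; rewrite exchange_big/=; apply: eq_bigr => i _.
  rewrite exchange_big/=; apply: eq_bigr => j _.
  rewrite -scaler_suml; congr (_ *: _); rewrite /gram -coframe_gram// mxE.
  by apply: eq_bigr => l _; rewrite !mxE.
have : normal_part A (hess_trace x) = - (lambda *: normal_part A (F x)).
  rewrite -H /hess_trace pair_big -normal_part_sum.
  by rewrite pair_big.
(* Solved for [hess_trace x]; adding the drift leaves exactly [- lambda *: F x]. *)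
rewrite /normal_part -/A -/(gram x) => /eqP; rewrite subr_eq => /eqP E.
rewrite -addrA -dotvDr {1}E /shrinker_drift -/A mulNmx !mulmxDl.
rewrite -!scalemxAl scalerBr opprB opprD.
rewrite -!addrA [X in dotv _ X](_ : _ = - (lambda *: F x)).
  by rewrite dotvNr dotvZr.
apply/rowP => i; rewrite !mxE; ring.
Qed.

Lemma cvg_coframe (x : 'rV[R]_n) (Fl : set_system 'rV[R]_n) : Filter Fl ->
  gram x \in unitmx -> jac F @ Fl --> jac F x ->
  (fun y => coframe (jac F y)) @ Fl --> coframe (jac F x).
Proof.
move=> FF gu cJ; apply: cvg_trmx; apply: cvg_mulmx => //.
by apply: cvg_invmx => //; apply: cvg_mulmx => //; exact: cvg_trmx.
Qed.

Lemma cvg_shrinker_drift (x : 'rV[R]_n) (Fl : set_system 'rV[R]_n) :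
  Filter Fl -> gram x \in unitmx -> jac F @ Fl --> jac F x -> F @ Fl --> F x ->
  (forall i j, partial2 F i j @ Fl --> partial2 F i j x) ->
  shrinker_drift @ Fl --> shrinker_drift x.
Proof.
move=> FF gu cJ cF cP.
have cg : gram @ Fl --> gram x by apply: cvg_mulmx => //; exact: cvg_trmx.
have cgi := (cvg_mxP _ _).1 (cvg_invmx gu cg).
have ch : hess_trace @ Fl --> hess_trace x.
  apply: cvg_big => [|i _]; first exact: add_continuous.
  apply: cvg_big => [|j _]; first exact: add_continuous.
  by apply: cvgZ; [exact: cgi|exact: cP].
apply: cvgN; apply: cvg_mulmx; last exact: cvg_invmx.
apply: cvg_mulmx; last exact: cvg_trmx.
by apply: cvgD => //; apply: cvgZ => //; exact: cvg_cst.
Qed.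

End drift_laplacian.

Section shrinker_chart.
Context {R : realType} {n k : nat} (U : set 'rV[R]_n).
Variables (F : 'rV[R]_n -> 'rV[R]_k) (lambda : R).
Hypothesis oU : open U.
Hypothesis sF : Ck_on 2 U F.
Hypothesis gram_unit : forall x, U x -> jac F x *m (jac F x)^T \in unitmx.
Hypothesis shrinkerF : forall x, U x ->
  \sum_(i < n) \sum_(j < n) invmx (jac F x *m (jac F x)^T) i j *:
    normal_part (jac F x) (partial2 F i j x) =
  - (lambda *: normal_part (jac F x) (F x)).

Variables (e r2 : R).
Hypothesis r2E : lambda * r2 = n%:R.

(** [e] is a sign, later [-1] or [1], so that one argument treats both confinements. *)
Definition sqr_radius_gap (x : 'rV[R]_n) : R := e * (dotv (F x) (F x) - r2).
Local Notation w := sqr_radius_gap.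

Let nU x : U x -> \forall y \near x, U y.
Proof. by move=> Ux; exact: open_nbhs_nbhs. Qed.

Let dF x : U x -> differentiable F x.
Proof. by case: sF => + _; exact. Qed.

Let ddF v x : U x -> differentiable ('D_v F) x.
Proof. by case: sF => _ /(_ v)[+ _]; exact. Qed.

Let cddF v v' x : U x -> {for x, continuous ('D_v' ('D_v F))}.
Proof. by case: sF => _ /(_ v)[_ /(_ v')]; exact. Qed.

Let ndF x : U x -> \forall y \near x, differentiable F y.
Proof. by move=> /nU; apply: filterS => y; exact: dF. Qed.

Let u (x : 'rV[R]_n) := dotv (F x) (F x).

(** Puts the gap in the shape of [elliptic_opB], with coefficient [- e]. *)
Let wE : w = cst (- (e * r2)) - (- e) *: u.
Proof.
by apply/funext => x; rewrite /w /= !fctE /GRing.scale/= /u; ring.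
Qed.

Let du x v : U x -> derivable u x v.
Proof.
by move=> Ux; exact: (is_derive_derivable (is_derive_sqr_norm v (dF Ux))).
Qed.

Let ddu x v : U x -> derivable ('D_v u) x v.
Proof.
move=> Ux.
exact: (is_derive_derivable (is_derive2_sqr_norm (ndF Ux) (ddF v Ux))).
Qed.

Lemma derivable_gap x v : U x -> derivable w x v.
Proof.
move=> Ux; rewrite wE; apply: derivableB => //.
by apply: derivableZ; exact: du.
Qed.

Let derive_cst0 v (a : R) : 'D_v (cst a : 'rV[R]_n -> R) = cst 0.
Proof. by apply/funext => x; rewrite derive_cst. Qed.

Lemma derivable2_gap x v : U x -> derivable ('D_v w) x v.
Proof.
move=> Ux; have E : \forall y \near x,
    ('D_v (cst (- (e * r2)) : 'rV[R]_n -> R) - (- e) *: 'D_v u) y = 'D_v w y.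
  apply: filterS (nU Ux) => y Uy; have duy : derivable u y v by exact: du.
  by rewrite wE deriveB//; [rewrite deriveZ|exact: derivableZ].
apply: (near_eq_derivable E); rewrite derive_cst0.
by apply: derivableB => //; apply: derivableZ; exact: ddu.
Qed.

Lemma differentiable_gap x : U x -> differentiable w x.
Proof.
move=> Ux; rewrite wE; apply: differentiableB => //.
by apply: differentiableZ; apply: differentiable_sqr_norm; exact: dF.
Qed.

(** The operator kills the constant, and [lambda * r2 = n] turns the right-hand side for the squared
    norm into a multiple of the gap. *)
Lemma drift_laplacian_gap x : U x ->
  drift_laplacian F lambda w x = - (2 * lambda * w x).
Proof.
move=> Ux; rewrite wE /drift_laplacian elliptic_opB; last first.
- by move=> v; exact: ddu.
- by move=> v; rewrite derive_cst0.
- by apply: filterS (nU Ux) => y Uy v; exact: du.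
- by apply: filterS (nU Ux) => y Uy v.
have -> : elliptic_op (fun x => coframe (jac F x)) (shrinker_drift F lambda)
    (cst (- (e * r2))) x = 0.
  rewrite /elliptic_op derive_cst addr0 big1// => l _.
  by rewrite derive_cst0 derive_cst.
rewrite -/(drift_laplacian F lambda u x) drift_laplacian_sqr_norm//.
- by rewrite -/(u x) -r2E !fctE /GRing.scale/=; ring.
- exact: ndF.
- by move=> v; exact: ddF.
- exact: gram_unit.
- exact: shrinkerF.
Qed.

(** At such a point [0 <= L w q = - 2 * lambda * w q], and [lambda] is positive. *)
Lemma gap_local_min q : 0 < lambda -> U q ->
  (\forall x \near q, w q <= w x) -> w q <= 0.
Proof.
move=> l0 Uq qmin; have : 0 <= drift_laplacian F lambda w q.
  apply: elliptic_op_local_min => //.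
  - by apply: filterS (nU Uq) => y Uy v; exact: derivable_gap.
  - by move=> v; exact: derivable2_gap.
by rewrite drift_laplacian_gap// oppr_ge0 pmulr_rle0// mulr_gt0.
Qed.

(** Nonnegativity of [w] gives [L w = - 2 * lambda * w <= 0], and second-order smoothness of [F]
    makes the coefficients continuous, as the strong minimum principle requires. *)
Lemma gap_zeros_open x0 : 0 < lambda -> (forall x, U x -> 0 <= w x) ->
  U x0 -> w x0 = 0 -> \forall x \near x0, w x = 0.
Proof.
move=> l0 w0 Ux0 wx0.
have cJ x : U x -> {for x, continuous (jac F)}.
  move=> Ux; have gen (Fl : set_system 'rV[R]_n) : Filter Fl ->
      (forall v, 'D_v F @ Fl --> 'D_v F x) -> jac F @ Fl --> jac F x.
    move=> FF cv; apply/cvg_mxP => i j; rewrite mxE.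
    under eq_cvg do rewrite mxE.
    exact: (cvg_mxP _ _).1 (cv (basis_vec R i)) 0 j.
  apply: gen (nbhs_filter x) _ => v.
  exact: (differentiable_continuous (ddF v Ux)).
have csigma x : U x -> {for x, continuous (fun x => coframe (jac F x))}.
  move=> Ux; exact: (cvg_coframe (nbhs_filter x) (gram_unit Ux) (cJ x Ux)).
have cbeta x : U x -> {for x, continuous (shrinker_drift F lambda)}.
  move=> Ux; have cP i j : {for x, continuous (partial2 F i j)}.
    rewrite (_ : partial2 F i j = 'D_(basis_vec R i) ('D_(basis_vec R j) F))//.
    exact: cddF.
  have cF : {for x, continuous F} := differentiable_continuous (dF Ux).
  exact: (@cvg_shrinker_drift _ _ _ F lambda _ _ (nbhs_filter x) (gram_unit Ux)
    (cJ x Ux) cF cP).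
have fsigma x : U x -> row_full (coframe (jac F x)).
  by move=> Ux; apply: row_full_coframe; exact: gram_unit.
have Lw x : U x -> drift_laplacian F lambda w x <= 0.
  move=> Ux; rewrite drift_laplacian_gap// oppr_le0.
  by rewrite mulr_ge0 ?w0// mulr_ge0// ltW.
exact: (strong_minimum_principle oU differentiable_gap
  (fun v x => @derivable2_gap x v) csigma cbeta fsigma w0 Lw Ux0 wx0).
Qed.

End shrinker_chart.

(** Orthogonality gives [normal_part A y = y], so the equation prescribes the component of [v] along
    [y]; removing it leaves [v + lambda *: y], whose normal part cancels. In the application [y] is
    the position and [v] the trace of second derivatives. *)
Lemma normal_part_normal_part_eq0 (R : realType) (l k : nat)
    (A : 'M[R]_(l, k)) (y v : 'rV[R]_k) (lambda : R) :
  A *m y^T = 0 -> y *m y^T \in unitmx ->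
  normal_part A v = - (lambda *: normal_part A y) ->
  normal_part A (normal_part y v) = 0.
Proof.
move=> Ay yu; have yA : y *m A^T = 0.
  by apply: trmx_inj; rewrite trmx_mul trmxK Ay trmx0.
have nAy : normal_part A y = y by rewrite /normal_part yA !mul0mx subr0.
rewrite nAy => nAv.
have vy : v *m y^T = - lambda *: (y *m y^T).
  have -> : v = - lambda *: y + v *m A^T *m invmx (A *m A^T) *m A.
    by rewrite scaleNr -nAv subrK.
  by rewrite mulmxDl -!mulmxA Ay !mulmx0 addr0 scalemxAl.
have -> : normal_part y v = v + lambda *: y.
  rewrite /normal_part vy -scalemxAl mulmxV// -scalemxAl mul1mx.
  by rewrite scaleNr opprK.
have -> : normal_part A (v + lambda *: y) =
    normal_part A v + lambda *: normal_part A y.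
  rewrite /normal_part !mulmxDl -!scalemxAl scalerBr opprD !addrA.
  by congr (_ - _); rewrite addrAC.
by rewrite nAy nAv addNr.
Qed.

(** Bounded through [sqr_norm_le_dotv], closed as a sublevel set; these Euclidean balls are the
    compact sets fed to properness. *)
Lemma compact_dotv_le (R : realType) (k : nat) (M : R) :
  compact [set x : 'rV[R]_k | dotv x x <= M].
Proof.
apply: bounded_closed_compact.
  exists (Num.sqrt `|M|); split; first by rewrite num_real.
  move=> N HN x /= xM; apply/ltW; apply: le_lt_trans HN.
  rewrite -[leLHS]ger0_norm// -sqrtr_sqr ler_wsqrtr//.
  by rewrite (le_trans (sqr_norm_le_dotv x))// (le_trans xM)// ler_norm.
have -> : [set x : 'rV[R]_k | dotv x x <= M] =
    (fun x => dotv x x) @^-1` [set t | t <= M] by [].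
apply: preimage_closed; last exact: closed_le.
move=> x _; exact: (@cvg_dotv R _ (nbhs x) _ k id id x x cvg_id cvg_id).
Qed.

(** * Global argument on the manifold *)

Section shrinker.
Context {R : realType} {n k : nat} {S : riemannian_manifold R n}.
Variables (X : S -> 'rV[R]_k) (lambda : R).
Hypothesis shrinkerX : self_shrinker lambda X.

Lemma metric_jac c x : atlas c -> chart_cod c x ->
  metric c x = jac (in_chart X c) x *m (jac (in_chart X c) x)^T.
Proof.
move=> ac Ux; have [_ [_ isoX] _ _] := shrinkerX; apply/matrixP => i j.
have := isoX c _ ac (chart_inv_dom Ux) i j.
rewrite /tangent_frame chart_invK// => ->; rewrite mxE.
by apply: eq_bigr => l _; rewrite !mxE.
Qed.

(** A kernel vector would have zero length for the metric, against [metric_pos]. *)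
Lemma gram_jac_unit c x : atlas c -> chart_cod c x ->
  jac (in_chart X c) x *m (jac (in_chart X c) x)^T \in unitmx.
Proof.
move=> ac Ux; rewrite -metric_jac// -row_free_unit -kermx_eq0.
apply: contraT => /rowV0Pn[v /sub_kermxP vg v0].
by have := metric_pos ac Ux v0; rewrite vg mul0mx mxE ltxx.
Qed.

Lemma shrinker_in_chart c x : atlas c -> chart_cod c x ->
  \sum_(i < n) \sum_(j < n)
    invmx (jac (in_chart X c) x *m (jac (in_chart X c) x)^T) i j *:
    normal_part (jac (in_chart X c) x) (partial2 (in_chart X c) i j x) =
  - (lambda *: normal_part (jac (in_chart X c) x) (in_chart X c x)).
Proof.
move=> ac Ux; have [_ _ _ HX] := shrinkerX.
have := HX c _ ac (chart_inv_dom Ux).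
rewrite /mean_curvature /metric_trace /second_fund_form /tangent_frame.
by rewrite chart_invK// metric_jac.
Qed.

Lemma smooth_in_chart c : atlas c -> Ck_on 2 (chart_cod c) (in_chart X c).
Proof. by move=> ac; have [_ [[sX _] _] _ _] := shrinkerX; exact: sX. Qed.

Lemma continuous_shrinker : continuous X.
Proof.
move=> p; have [c ac dp] := atlas_cover p.
have cF : {for chart_map c p, continuous (in_chart X c)}.
  apply: differentiable_continuous; apply: (smooth_in_chart ac).1.
  exact: chart_map_cod.
(* [chart_inv] undoes [chart_map] only on the chart domain, hence a local factorisation. *)
have E : \forall q \near p, (in_chart X c \o chart_map c) q = X q.
  have : \forall q \near p, chart_dom c q.
    by apply: open_nbhs_nbhs; split=> //; exact: chart_dom_open.
  by apply: filterS => q dq; rewrite /in_chart /= chart_mapK.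
rewrite /continuous_at -(nbhs_singleton E).
apply: cvg_trans (near_eq_cvg E) _.
exact: cvg_comp (chart_map_continuous dp) cF.
Qed.

(** The last hypothesis, with properness, supplies compactness of the sublevel sets of the gap even
    when the confining region is unbounded. *)
Lemma shrinker_gap_eq0 (e r2 : R) :
  (forall K : set 'rV[R]_k, compact K -> compact (X @^-1` K)) ->
  lambda * r2 = n%:R ->
  (forall p, 0 <= e * (dotv (X p) (X p) - r2)) ->
  (forall t, exists2 K : set 'rV[R]_k, compact K &
     forall p, e * (dotv (X p) (X p) - r2) <= t -> K (X p)) ->
  forall p, e * (dotv (X p) (X p) - r2) = 0.
Proof.
move=> properX r2E W0 Wproper.
have [_ _ l0 _] := shrinkerX.
pose W (p : S) := e * (dotv (X p) (X p) - r2).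
have gapE c x : W (chart_inv c x) = sqr_radius_gap (in_chart X c) e r2 x by [].
have cW : continuous W.
  move=> p; have gen (F : set_system S) : Filter F -> X @ F --> X p ->
      W @ F --> W p.
    move=> FF cX; apply: cvgM; first exact: cvg_cst.
    by apply: cvgB; [exact: cvg_dotv|exact: cvg_cst].
  exact: gen (nbhs_filter p) (@continuous_shrinker p).
have Zopen p : W p = 0 -> \forall q \near p, W q = 0.
  move=> Wp; have [c ac dp] := atlas_cover p.
  have Ux : chart_cod c (chart_map c p) by exact: chart_map_cod.
  have : \forall x \near chart_map c p,
      sqr_radius_gap (in_chart X c) e r2 x = 0.
    have w0 x : chart_cod c x -> 0 <= sqr_radius_gap (in_chart X c) e r2 x.
      by move=> _; rewrite -gapE; exact: W0.
    have wx0 : sqr_radius_gap (in_chart X c) e r2 (chart_map c p) = 0.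
      by rewrite -gapE chart_mapK.
    exact: (gap_zeros_open (chart_cod_open (c:=c)) (smooth_in_chart ac)
      (fun x => @gram_jac_unit c x ac) (fun x => @shrinker_in_chart c x ac)
      r2E l0 w0 Ux wx0).
  move=> /(chart_map_continuous dp) nearp.
  have Hq : \forall q \near p,
    sqr_radius_gap (in_chart X c) e r2 (chart_map c q) = 0 by exact: nearp.
  have Hd : \forall q \near p, chart_dom c q.
    by apply: open_nbhs_nbhs; split=> //; exact: chart_dom_open.
  apply: filterS2 Hq Hd => q; rewrite /= -gapE => <- dq.
  by rewrite chart_mapK.
move=> p0; apply/eqP; apply: contraT => Wp0.
pose C := [set p | W p != 0].
(* Its complement, the zero set, is open by the strong minimum principle. *)
have Cclosed : closed C.
  move=> p clp; apply/negP => /eqP /Zopen /clp[q [/negP]].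
  by move=> + Wq; apply; apply/eqP.
(* Cutting at the level [W p0] makes the set compact, and it still contains [p0]. *)
have [q [Cq Wq] qmin] : exists2 q, (C `&` [set p | W p <= W p0]) q &
    forall p, (C `&` [set p | W p <= W p0]) p -> W q <= W p.
  have [K cK HK] := Wproper (W p0).
  apply: compact_argmin; first by exists p0; split=> //=.
    apply: subclosed_compact (properX K cK) _; last by move=> p [_ /HK].
    apply: closedI => //.
    have -> : [set p | W p <= W p0] = W @^-1` [set t | t <= W p0] by [].
    by apply: preimage_closed; [move=> x _; exact: cW|exact: closed_le].
  by move=> x _; exact: cW.
(* [C] is open by continuity, and nearby points above the level [W p0] already exceed [W q]. *)
have locmin : \forall p \near q, W q <= W p.
  have Cnear : \forall p \near q, W p != 0.
    exact: (cvgr_neq0 _ (cW q) Cq).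
  apply: filterS Cnear => p Cp.
  by have [Wp|/ltW Wp] := leP (W p) (W p0); [exact: qmin|exact: le_trans Wp].
have [c ac dq] := atlas_cover q.
have Ux : chart_cod c (chart_map c q) by exact: chart_map_cod.
have := gap_local_min (chart_cod_open (c:=c)) (smooth_in_chart ac)
  (fun x => @gram_jac_unit c x ac) (fun x => @shrinker_in_chart c x ac)
  r2E l0 Ux (e := e).
rewrite -gapE chart_mapK// => Wle0.
suff Wq0 : W q <= 0 by move: Cq; rewrite /C /= eq_le Wq0 W0.
apply: Wle0.
(* Transports local minimality to coordinates. *)
have cinv : chart_inv c @ chart_map c q --> chart_inv c (chart_map c q).
  exact: chart_inv_continuous.
rewrite chart_mapK// in cinv.
exact: cinv _ locmin.
Qed.

(** Differentiating the constant squared norm makes the position vector normal; once linearity moves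
    the metric trace inside both projections, [normal_part_normal_part_eq0] applies. *)
Lemma shrinker_sphere_minimal (r2 : R) : r2 != 0 ->
  (forall p, dotv (X p) (X p) = r2) ->
  forall c p, atlas c -> chart_dom c p -> sphere_mean_curvature X c p = 0.
Proof.
move=> r20 Xr c p ac dp; have Ux : chart_cod c (chart_map c p).
  exact: chart_map_cod.
set x := chart_map c p in Ux *; pose F := in_chart X c.
have Fx : F x = X p by rewrite /F /in_chart /= chart_mapK.
have dF : differentiable F x by exact: (smooth_in_chart ac).1.
rewrite /sphere_mean_curvature /metric_trace /sphere_second_fund_form.
rewrite /tangent_frame -/x -/F metric_jac// -/F pair_big/=.
rewrite normal_part_sum.
rewrite (normal_part_sum _ (fun ij : 'I_n * 'I_n => partial2 F ij.1 ij.2 x)).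
apply: (@normal_part_normal_part_eq0 _ _ _ _ _ _ lambda).
- apply/matrixP => i j; rewrite (ord1 j) !mxE.
  have : 'D_(basis_vec R i) (fun y => dotv (F y) (F y)) x = 0.
    have -> : (fun y => dotv (F y) (F y)) = cst r2.
      by apply/funext => y; exact: Xr.
    by rewrite derive_cst.
  rewrite (is_deriveE (is_derive_sqr_norm _ dF)) Fx => /eqP.
  rewrite mulf_eq0 pnatr_eq0/= dotvC => /eqP orthX; rewrite -[RHS]orthX.
  by apply: eq_bigr => l _; rewrite !mxE.
- rewrite unitmxE det_mx11 -dotvE Xr unitfE//.
- rewrite -(normal_part_sum _ (fun ij : 'I_n * 'I_n => partial2 F ij.1 ij.2 x)).
  rewrite -Fx -shrinker_in_chart// pair_big//.
Qed.

End shrinker.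

Unset Implicit Arguments.

Theorem theorem7p5 (R : realType) (n m : nat) (n_ge1 : (1 <= n)%N)
    (m_ge1 : (1 <= m)%N) (S : riemannian_manifold R n)
    (X : S -> 'rV[R]_(n + m)) (lambda : R) :
  self_shrinker lambda X ->
  proper_immersion X ->
  range X `<=` [set x | enorm x <= Num.sqrt (n%:R / lambda)] \/
  range X `<=` [set x | Num.sqrt (n%:R / lambda) <= enorm x] ->
  [/\ compact [set: S],
      range X `<=` esphere (Num.sqrt (n%:R / lambda)) &
      minimal_immersion_in_sphere (Num.sqrt (n%:R / lambda)) X].
Proof.
move=> shrinkerX [_ properX] confined.
have [_ isoX l0 _] := shrinkerX.
set r2 := n%:R / lambda in confined *.
have r2_gt0 : 0 < r2 by rewrite divr_gt0// ltr0n.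
have r2E : lambda * r2 = n%:R by rewrite mulrC divfK// gt_eqF.
have normX p : dotv (X p) (X p) = r2.
  have [le_r|ge_r] := confined.
    have Xle q : dotv (X q) (X q) <= r2.
      rewrite -ler_sqrt; last exact: ltW.
      by apply: le_r; exists q.
    (* Inside the ball the sign is [-1], and the ball itself serves as compact set for every [t]. *)
    have H : -1 * (dotv (X p) (X p) - r2) = 0.
      apply: (shrinker_gap_eq0 shrinkerX properX r2E) => [q|t].
        by rewrite mulN1r oppr_ge0 subr_le0.
      exists [set x | dotv x x <= r2]; first exact: compact_dotv_le.
      by move=> q _; exact: Xle.
    by apply/eqP; rewrite -subr_eq0 -oppr_eq0 -mulN1r H.
  have Xge q : r2 <= dotv (X q) (X q).
    rewrite -ler_sqrt; last exact: dotv_ge0.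
    by apply: ge_r; exists q.
  (* Outside the ball a gap at most [t] bounds the squared norm by [t + r2]. *)
  have H : 1 * (dotv (X p) (X p) - r2) = 0.
    apply: (shrinker_gap_eq0 shrinkerX properX r2E) => [q|t].
      by rewrite mul1r subr_ge0.
    exists [set x | dotv x x <= t + r2]; first exact: compact_dotv_le.
    by move=> q; rewrite mul1r lerBlDr.
  by apply/eqP; rewrite -subr_eq0 -[eqbLHS]mul1r H.
have sphereX p : esphere (Num.sqrt r2) (X p).
  by rewrite /esphere /= /enorm normX.
split.
(* All of [S] is the preimage of a closed ball, so properness applies. *)
- have -> : [set: S] = X @^-1` [set x | dotv x x <= r2].
    by apply/seteqP; split=> p //= _; rewrite normX.
  exact/properX/compact_dotv_le.
- by move=> _ [p _ <-].
- split=> // c p ac dp.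
  by apply: (shrinker_sphere_minimal shrinkerX _ normX) => //; rewrite gt_eqF.
Qed.
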